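(* Let $I$ be an SF instance. For every GSP $\Pi$ of $I$, the half-matching $w_\Pi$ associated with $\Pi$ is a stable half-matching of $I$; conversely, for every stable half-matching $w$ of $I$ there is a GSP $\Pi$ of $I$ with $w_\Pi=w$. (That is, every GSP corresponds to a stable half-matching and vice versa.)
   Context: A Stable Fixtures (SF) instance is $I=(A,\succ,c)$ where $A=\{a_1,\dots,a_n\}$ is a finite set of $n$ agents; each agent $a_i$ has a strict linear order $\succ_i$ over $A\setminus\{a_i\}$ (complete preference list), with the convention that every agent ranks itself last ($a_j\succ_i a_i$ for all $j\neq i$); $a\succeq_i b$ means $a\succ_i b$ or $a=b$. Each agent has an integer capacity $c_i$ with $1\le c_i<n$. A half-matching of $I$ is a function $w$ from unordered pairs of distinct agents to $\{0,\tfrac12,1\}$ with $\sum_{j\neq i}w(\{a_i,a_j\})\le c_i$ for all $i$. Agent $a_k$ ranks pairs containing it by the rank of the other agent: $\{a_k,a_l\}\succeq_k\{a_k,a_m\}$ iff $a_l\succeq_k a_m$. $w$ is stable if for every pair $e=\{a_i,a_j\}$ of distinct agents, either $w(e)=1$ or there is $a_k\in e$ with $\sum_{f\ni a_k,\ f\succeq_k e}w(f)=c_k$. A cyclic permutation of a nonempty set $A_r\subseteq A$ is a permutation $\Pi_r$ of $A_r$ consisting of a single cycle of length $|A_r|$ (length 1: a fixed point $(a_i)$; length 2: a transposition $(a_i\ a_j)$). Two cyclic permutations are distinct if some element is mapped to different elements by them. A GSP (generalised stable partition) of $I$ is a finite collection $\Pi=\{\Pi_1,\dots,\Pi_k\}$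 of cyclic permutations $\Pi_r$ of sets $A_r\subseteq A$, pairwise distinct except that fixed points may be repeated, such that: (F1) for every $r$ and every $a_j\in A_r$, $\Pi_r(a_j)\succeq_j\Pi_r^{-1}(a_j)$; (F2) there are no distinct $a_i,a_j\in A$ with the transposition $(a_i\ a_j)\notin\Pi$ such that $a_j\succ_i\Pi_r^{-1}(a_i)$ and $a_i\succ_j\Pi_s^{-1}(a_j)$ for some $\Pi_r,\Pi_s\in\Pi$ with $a_i\in A_r$, $a_j\in A_s$; (F3) for every $a_i\in A$, the number of indices $r$ with $a_i\in A_r$ equals $c_i$; (F4) for all distinct $a_i,a_j\in A$, $|\{s:\Pi_s(a_i)=a_j\}|+|\{s:\Pi_s(a_j)=a_i\}|\le 2$. The half-matching associated with a GSP $\Pi$ is $w_\Pi(\{a_i,a_j\})=\tfrac12\big(|\{s:\Pi_s(a_i)=a_j\}|+|\{s:\Pi_s(a_j)=a_i\}|\big)$ for distinct $a_i,a_j$ (each predecessor–successor pair in a cycle is a half-match; two half-matches form a full match). *)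

(* Defs.v *)
From mathcomp Require Import all_boot all_order all_algebra all_fingroup.
Set Implicit Arguments.
Unset Strict Implicit.
Unset Printing Implicit Defensive.
Import GRing.Theory.
Local Open Scope ring_scope.

(* [pref i a b] reads "agent i strictly prefers a to b".  The order of agent i
   on the other agents is extended to the whole of A by putting i last. *)
Record sf_instance (A : finType) := SFInstance {
  pref : A -> rel A;
  pref_irr : forall i, irreflexive (pref i);
  pref_trans : forall i, transitive (pref i);
  pref_total : forall i a b, a != b -> pref i a b || pref i b a;
  pref_self_last : forall i a, a != i -> pref i a i;
  cap : A -> nat;
  cap_bounds : forall i, (1 <= cap i < #|A|)%N
}.

Definition wpref (A : finType) (I : sf_instance A) (i a b : A) : bool :=
  (a == b) || pref I i a b.

Definition agent_pair (A : finType) := {e : {set A} | #|e| == 2%N}.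

Definition pair_wpref (A : finType) (I : sf_instance A) (k : A)
    (e f : agent_pair A) : bool :=
  [exists l, exists m,
    [&& val e == [set k; l], val f == [set k; m] & wpref I k l m]].

Definition half_matching (A : finType) (I : sf_instance A)
    (w : {ffun agent_pair A -> rat}) : Prop :=
  (forall e, w e \in [:: 0; 1 / 2%:R; 1]) /\
  (forall i, \sum_(e : agent_pair A | i \in val e) w e <= (cap I i)%:R).

Definition stable (A : finType) (I : sf_instance A)
    (w : {ffun agent_pair A -> rat}) : Prop :=
  forall e : agent_pair A, w e = 1 \/
    exists2 k, k \in val e &
      \sum_(f : agent_pair A | (k \in val f) && pair_wpref I k f e) w f
        = (cap I k)%:R.

(* A permutation of a subset S of A is encoded as the pair of S and of its
   extension to A by the identity.  S cannot be recovered from the permutation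
   when it is a singleton, i.e., for a fixed point. *)
Definition cyclic_perm (A : finType) (p : {set A} * {perm A}) : bool :=
  perm_on p.1 p.2 && [exists x in p.1, porbit p.2 x == p.1].

Definition succ_count (A : finType) (Pi : seq ({set A} * {perm A}))
    (i j : A) : nat :=
  count (fun p : {set A} * {perm A} =>
    (i \in p.1) && (p.2 i == j)) Pi.

(* A finite collection with possible repetitions is a sequence; nothing below
   depends on the order of its elements. *)
Record gsp (A : finType) (I : sf_instance A)
    (Pi : seq ({set A} * {perm A})) : Prop := GSP {
  gsp_cyclic : forall p, p \in Pi -> cyclic_perm p;
  gsp_distinct : uniq [seq p : {set A} * {perm A} <- Pi | #|p.1| != 1%N];
  gsp_F1 : forall p, p \in Pi ->
    forall j, j \in p.1 -> wpref I j (p.2 j) ((p.2)^-1%g j);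
  gsp_F2 : ~ exists i j,
    [/\ i != j, ([set i; j], tperm i j) \notin Pi &
      exists p q, [/\ p \in Pi /\ q \in Pi, i \in p.1 /\ j \in q.1,
        pref I i j ((p.2)^-1%g i) & pref I j i ((q.2)^-1%g j)]];
  gsp_F3 : forall i,
    count (fun p : {set A} * {perm A} => i \in p.1) Pi = cap I i;
  gsp_F4 : forall i j, i != j ->
    (succ_count Pi i j + succ_count Pi j i <= 2)%N
}.

(* For e = {i, j} the double sum has the two terms (i, j) and (j, i); see
   [gsp_half_matchingE]. *)
Definition gsp_half_matching (A : finType) (Pi : seq ({set A} * {perm A})) :
    {ffun agent_pair A -> rat} :=
  [ffun e : agent_pair A => 1 / 2%:R *
    (\sum_(i in val e) \sum_(j in val e | j != i) succ_count Pi i j)%N%:R].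

Lemma gsp_half_matchingE (A : finType) (Pi : seq ({set A} * {perm A}))
    (e : agent_pair A) (i j : A) :
  i != j -> val e = [set i; j] ->
  gsp_half_matching Pi e
    = 1 / 2%:R * (succ_count Pi i j + succ_count Pi j i)%N%:R.
Proof.
move=> ij eE; rewrite ffunE eE; congr (_ * _%:R).
rewrite big_setU1 ?inE // big_set1; congr (_ + _)%N.
  rewrite (big_pred1 j) // => x; rewrite !inE /=.
  by case: (eqVneq x i) => [->|_] /=; rewrite ?andbF ?andbT // (negPf ij).
rewrite (big_pred1 i) // => x; rewrite !inE /=.
by case: (eqVneq x j) => [->|_] /=;
  rewrite ?andbF ?andbT ?orbF // eq_sym (negPf ij).
Qed.

(* Main.v *)
Require Import Defs.
From mathcomp Require Import all_boot all_order all_algebra all_fingroup.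
From mathcomp Require Import zify.

(* Twice a half-matching is a symmetric multiplicity function on pairs of
   agents.  By (F1) predecessors are the worse neighbours in a collection of
   cycles, so an agent is saturated by partners at least as good as j iff all
   its predecessors are at least as good as j: (F2) is stability in disguise.

   Conversely, in a stable half-matching every half-edge is the least preferred
   positive edge of a saturated end.  Saturation makes the number of half-edges
   at such an end even, so counting half-edges by their ends shows that each
   agent has 0 or 2 half-edges and each half-edge is least for exactly one end.
   Sending each agent to its least half-partner is thus a permutation; the
   nontrivial cycles of its inverse, the full edges as transpositions, and
   fixed points for the unused capacity form the partition. *)

Set Implicit Arguments.
Unset Strict Implicit.
Unset Printing Implicit Defensive.

Import Order.TTheory GRing.Theory Num.Theory.

(** * Preference orders and pairs of agents *)

Lemma wpref_refl (A : finType) (I : sf_instance A) (i a : A) : wpref I i a a.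
Proof. by rewrite /wpref eqxx. Qed.

Lemma wprefNpref (A : finType) (I : sf_instance A) (i a b : A) :
  wpref I i a b = ~~ pref I i b a.
Proof.
rewrite /wpref; case: eqVneq => [->|ab] /=; first by rewrite pref_irr.
apply/idP/idP => [pab|]; last by case/orP: (pref_total I i ab) => ->.
by apply/negP => /(pref_trans pab); rewrite pref_irr.
Qed.

Lemma wpref_anti (A : finType) (I : sf_instance A) (i a b : A) :
  wpref I i a b -> wpref I i b a -> a = b.
Proof. by rewrite wprefNpref /wpref => /negPf->; rewrite orbF => /eqP. Qed.

Lemma wpref_self (A : finType) (I : sf_instance A) (i j : A) :
  j != i -> wpref I i i j = false.
Proof. by move=> ji; rewrite wprefNpref pref_self_last. Qed.

Lemma set2_inj (A : finType) (i j k : A) :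
  j != i -> [set i; j] = [set i; k] -> j = k.
Proof.
move=> ji E; have : j \in [set i; k] by rewrite -E !inE eqxx orbT.
by rewrite !inE (negPf ji) => /eqP.
Qed.

Lemma agent_pairP (A : finType) (e : agent_pair A) (i : A) :
  i \in val e -> exists2 j, j != i & val e = [set i; j].
Proof.
have /cards2P[x [y [xy ->]]] := valP e.
rewrite !inE => /orP[/eqP->|/eqP->]; first by exists y; rewrite // eq_sym.
by exists x; rewrite // setUC.
Qed.

Lemma agent_pair_exists (A : finType) (i j : A) :
  j != i -> exists e : agent_pair A, val e = [set i; j].
Proof.
move=> ji; have c2 : #|[set i; j]| == 2 by rewrite cards2 (eq_sym i) ji.
by exists (Sub [set i; j] c2).
Qed.

(** * Half-matchings and stability in terms of integer multiplicities *)

Definition doubled (A : finType) (w : {ffun agent_pair A -> rat})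
    (v : A -> A -> nat) : Prop :=
  forall (e : agent_pair A) i j, i != j -> val e = [set i; j] ->
    w e = ((v i j)%:R / 2%:R)%R.

(** For [j != i] the sum skips [l = i], since an agent ranks itself last; [doubled] leaves the
    diagonal of [v] free. *)
Definition saturated (A : finType) (I : sf_instance A) (v : A -> A -> nat)
    (i j : A) : Prop :=
  \sum_(l | wpref I i l j) v i l = (cap I i).*2.

Definition nat_stable (A : finType) (I : sf_instance A)
    (v : A -> A -> nat) : Prop :=
  forall i j, i != j -> [\/ v i j = 2, saturated I v i j | saturated I v j i].

Lemma sum_agent_pairs (A : finType) (w : {ffun agent_pair A -> rat})
    (v : A -> A -> nat) (i : A) (P : pred (agent_pair A)) (Q : pred A) :
  doubled w v ->
  (forall (e : agent_pair A) j, j != i -> val e = [set i; j] -> P e = Q j) ->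
  (\sum_(e : agent_pair A | (i \in val e) && P e) w e =
    (\sum_(j | (j != i) && Q j) v i j)%N%:R / 2%:R)%R.
Proof.
move=> wv PQ.
(* Each [w e] becomes a one-term sum over the partner of [i] in [e]; after exchanging the sums, one
   pair remains for each partner. *)
rewrite (eq_bigr (fun e : agent_pair A =>
    \sum_(j | (j != i) && (val e == [set i; j])) w e)%R); last first.
  move=> e /andP[/agent_pairP[j ji eE] _]; rewrite (big_pred1 j) // => k /=.
  apply/andP/eqP => [[ki /eqP]|->]; last by rewrite ji eE.
  by rewrite eE => /(set2_inj ji).
rewrite (exchange_big_dep (fun j => (j != i) && Q j)) /=; last first.
  by move=> e j /andP[_ Pe] /andP[ji /eqP eE]; rewrite ji -(PQ e).
rewrite natr_sum mulr_suml; apply: eq_bigr => j /andP[ji Qj].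
have [e eE] := agent_pair_exists ji.
rewrite (big_pred1 e) => [|f /=]; first by apply: wv; rewrite // eq_sym.
apply/idP/eqP => [/andP[_ /andP[_ /eqP]]|->].
  by rewrite -eE => /val_inj.
by rewrite (PQ _ j) // Qj ji eE !inE !eqxx.
Qed.

Lemma pair_wprefE (A : finType) (I : sf_instance A) (e f : agent_pair A)
    (i j k : A) : j != i -> k != i ->
  val e = [set i; j] -> val f = [set i; k] ->
  pair_wpref I i f e = wpref I i k j.
Proof.
move=> ji ki eE fE; apply/existsP/idP => [[l /existsP[m]]|kj].
  by rewrite eE fE => /and3P[/eqP/(set2_inj ki)-> /eqP/(set2_inj ji)->].
by exists k; apply/existsP; exists j; rewrite eE fE !eqxx.
Qed.

Lemma natr_half_eq (m n : nat) :
  ((m%:R / 2%:R = n%:R :> rat)%R <-> m = n.*2).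
Proof.
split=> [E|->]; last by rewrite -muln2 natrM mulfK.
by apply/eqP; rewrite -(eqr_nat rat) -muln2 natrM -E divfK.
Qed.

Lemma half_natr_mem (n : nat) :
  ((n%:R / 2%:R : rat) \in [:: 0; 1 / 2%:R; 1])%R = (n <= 2).
Proof.
have half_inj m p : (m%:R / 2%:R == p%:R / 2%:R :> rat)%R = (m == p).
  by rewrite (can_eq (divfK _)) ?eqr_nat ?pnatr_eq0.
have E0 : (n%:R / 2%:R == 0 :> rat)%R = (n == 0).
  by rewrite -(half_inj n 0) mul0r.
have E2 : (n%:R / 2%:R == 1 :> rat)%R = (n == 2).
  by rewrite -(half_inj n 2) divff ?pnatr_eq0.
rewrite !inE E0 E2 (half_inj n 1).
by case: n {E0 E2} => [|[|[|n]]].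
Qed.

Lemma doubled_half_matching (A : finType) (I : sf_instance A)
    (w : {ffun agent_pair A -> rat}) (v : A -> A -> nat) : doubled w v ->
  half_matching I w <->
    (forall i j, i != j -> v i j <= 2) /\
    (forall i, \sum_(j | j != i) v i j <= (cap I i).*2).
Proof.
move=> wv.
have sumE i : (\sum_(e : agent_pair A | i \in val e) w e =
    (\sum_(j | j != i) v i j)%N%:R / 2%:R)%R.
  rewrite -(eq_bigl _ _ (fun j => andbT (j != i))).
  rewrite -(sum_agent_pairs (P := xpredT) wv) //.
  by apply: eq_bigl => e; rewrite andbT.
have leE i : (\sum_(e : agent_pair A | i \in val e) w e <= (cap I i)%:R)%R =
    (\sum_(j | j != i) v i j <= (cap I i).*2).
  by rewrite sumE ler_pdivrMr // -natrM ler_nat muln2.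
have wE (e : agent_pair A) i j : i != j -> val e = [set i; j] ->
    (w e \in [:: 0; 1 / 2%:R; 1]%R) = (v i j <= 2).
  by move=> ij eE; rewrite (wv e i j ij eE) half_natr_mem.
split=> -[w012 wcap]; split.
- move=> i j ij; have [|e eE] := @agent_pair_exists _ i j.
    by rewrite eq_sym.
  by rewrite -(wE e).
- by move=> i; rewrite -leE.
- move=> e; have /cards2P[x [y [xy eE]]] := valP e.
  by rewrite (wE e x y) // w012.
- by move=> i; rewrite leE.
Qed.

Lemma doubled_stable (A : finType) (I : sf_instance A)
    (w : {ffun agent_pair A -> rat}) (v : A -> A -> nat) : doubled w v ->
  stable I w <-> nat_stable I v.
Proof.
move=> wv.
have satE (e : agent_pair A) i j : j != i -> val e = [set i; j] ->
    (\sum_(f : agent_pair A | (i \in val f) && pair_wpref I i f e) w f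
      = (cap I i)%:R)%R <->
    saturated I v i j.
  move=> ji eE; rewrite (sum_agent_pairs (Q := fun l => wpref I i l j) wv).
    rewrite natr_half_eq /saturated (eq_bigl (fun l => wpref I i l j)) // => l.
    by case: eqVneq => //= ->; rewrite wpref_self.
  by move=> f l li fE; rewrite (pair_wprefE _ ji li).
have oneE (e : agent_pair A) i j : j != i -> val e = [set i; j] ->
    (w e = 1)%R <-> v i j = 2.
  move=> ji eE; rewrite (wv e i j) // 1?eq_sym //.
  exact: (natr_half_eq _ 1).
split=> [st i j ij|st e].
  have ji : j != i by rewrite eq_sym.
  have [e eE] := agent_pair_exists ji.
  case: (st e) => [/(oneE e i j ji eE)|[k]]; first by constructor 1.
  rewrite eE !inE => /orP[]/eqP-> sumk; first by constructor 2; apply/(satE e).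
  by constructor 3; apply/(satE e); rewrite // eE setUC.
have /cards2P[i [j [ij eE]]] := valP e.
have ji : j != i by rewrite eq_sym.
have eE' : val e = [set j; i] by rewrite setUC.
case: (st i j ij) => [/(oneE e i j ji eE)|/(satE e i j ji eE)|].
- by left.
- by right; exists i; rewrite // eE !inE eqxx.
by move/(satE e j i ij eE'); right; exists j; rewrite // eE !inE eqxx orbT.
Qed.

(** * Counting links in a collection of cycles; (F2) versus stability *)

Definition link_count (A : finType) (Pi : seq ({set A} * {perm A}))
    (i j : A) : nat :=
  succ_count Pi i j + succ_count Pi j i.

Lemma doubled_link_count (A : finType) (Pi : seq ({set A} * {perm A})) :
  doubled (gsp_half_matching Pi) (link_count Pi).
Proof.
move=> e i j ij eE.
by rewrite (gsp_half_matchingE Pi ij eE) mul1r mulrC.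
Qed.

Lemma sum_count_fiber (T : Type) (A : finType) (a : pred T) (f : T -> A)
    (P : pred A) (s : seq T) :
  \sum_(j | P j) count (fun p => a p && (f p == j)) s =
  count (fun p => a p && P (f p)) s.
Proof.
elim: s => [|p s IH] /=; first by rewrite big1.
rewrite big_split IH /=; congr (_ + _)%N.
case: (a p) => /=; last by rewrite big1.
rewrite -big_mkcondr /= sum1_card.
have [Pf|Pf] /= := boolP (P (f p)).
  rewrite (eq_card (B := pred1 (f p))) ?card1 // => j; rewrite !inE eq_sym.
  by rewrite unfold_in /= eq_sym; case: eqVneq => [->|]; rewrite ?Pf ?andbF.
rewrite eq_card0 // => j; rewrite unfold_in /=.
by case: eqVneq => [<-|]; rewrite ?(negPf Pf) ?andbF.
Qed.

(** A cyclic permutation preserves its support, so membership of [j] can be traded for membership of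
    its image [i]. *)
Lemma succ_count_inv (A : finType) (Pi : seq ({set A} * {perm A})) (i j : A) :
  (forall p, p \in Pi -> cyclic_perm p) ->
  succ_count Pi j i = count (fun p : {set A} * {perm A} =>
    (i \in p.1) && ((p.2)^-1%g i == j)) Pi.
Proof.
move=> cyc; apply: eq_in_count => p /cyc/andP[pon _].
rewrite (can2_eq (permK p.2) (permKV p.2)) eq_sym.
case: eqVneq => [<-|]; rewrite ?andbF // !andbT.
by rewrite (perm_closed _ (perm_onV pon)).
Qed.

Lemma sum_link_count (A : finType) (Pi : seq ({set A} * {perm A})) (i : A)
    (P : pred A) : (forall p, p \in Pi -> cyclic_perm p) ->
  \sum_(j | P j) link_count Pi i j =
    count (fun p : {set A} * {perm A} => (i \in p.1) && P (p.2 i)) Pi +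
    count (fun p : {set A} * {perm A} => (i \in p.1) && P ((p.2)^-1%g i)) Pi.
Proof.
move=> cyc; rewrite big_split /= sum_count_fiber; congr (_ + _)%N.
by under eq_bigr do rewrite succ_count_inv //; rewrite sum_count_fiber.
Qed.

Lemma count_andP (T : eqType) (a b : pred T) (s : seq T) :
  reflect {in s, forall x, a x -> b x}
    (count (fun x => a x && b x) s == count a s).
Proof.
rewrite (eq_count (a2 := predI b a)) => [|x /=]; last by rewrite andbC.
rewrite -count_filter -(size_filter a) -all_count.
apply: (iffP allP) => [H x xs ax|H x]; first by apply: H; rewrite mem_filter ax.
by rewrite mem_filter => /andP[ax xs]; apply: H.
Qed.

(** The sum splits into a count of successors and a count of predecessors, each at most [cap I i] by
    (F3), so it reaches twice the capacity iff both are maximal. By (F1) good predecessors force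
    good successors. *)
Lemma saturated_link_count (A : finType) (I : sf_instance A)
    (Pi : seq ({set A} * {perm A})) (i j : A) :
  (forall p, p \in Pi -> cyclic_perm p) ->
  (forall p, p \in Pi -> forall k, k \in p.1 ->
     wpref I k (p.2 k) ((p.2)^-1%g k)) ->
  (forall k, count (fun p : {set A} * {perm A} => k \in p.1) Pi = cap I k) ->
  saturated I (link_count Pi) i j <->
    {in Pi, forall p : {set A} * {perm A},
      i \in p.1 -> wpref I i ((p.2)^-1%g i) j}.
Proof.
move=> cyc F1 F3; rewrite /saturated (sum_link_count _ (wpref I i ^~ j)) //.
have le_cap (P : pred ({set A} * {perm A})) :
    count (fun p : {set A} * {perm A} => (i \in p.1) && P p) Pi <= cap I i.
  by rewrite -F3; apply: sub_count => p /andP[].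
split=> [sat|pre].
  apply/count_andP/eqP; rewrite F3.
  have half_eq m n c : m <= c -> n <= c -> m + n = c.*2 -> n = c by lia.
  by apply: half_eq sat; apply: le_cap.
rewrite -addnn -F3; congr (_ + _)%N; apply/eqP/count_andP => // p pPi ip.
have := pre p pPi ip; rewrite !wprefNpref; apply: contra => jp.
have := F1 p pPi i ip; rewrite /wpref => /orP[/eqP<-//|].
exact: pref_trans.
Qed.

(** A transposition in [Pi] contributes one link in each direction, and (F4) allows no more. For any
    other pair, (F2) makes all predecessors good enough at one of the two ends, which is
    saturation. *)
Lemma gsp_nat_stable (A : finType) (I : sf_instance A)
    (Pi : seq ({set A} * {perm A})) : gsp I Pi -> nat_stable I (link_count Pi).
Proof.
move=> [cyc _ F1 F2 F3 F4] i j ij.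
have [tPi|tNPi] := boolP (([set i; j], tperm i j) \in Pi).
  constructor 1; have := F4 i j ij; rewrite /link_count.
  have succ_gt0 x y : x \in [set i; j] -> tperm i j x = y ->
      0 < succ_count Pi x y.
    move=> xij txy; rewrite -has_count; apply/hasP.
    by exists ([set i; j], tperm i j); rewrite //= xij txy eqxx.
  have := succ_gt0 i j; have := succ_gt0 j i.
  rewrite tpermL tpermR !inE !eqxx orbT /=.
  by move=> /(_ erefl erefl) ? /(_ erefl erefl) ?; lia.
pose pre x y := all (fun p : {set A} * {perm A} =>
  (x \in p.1) ==> wpref I x ((p.2)^-1%g x) y) Pi.
have preP x y : pre x y -> saturated I (link_count Pi) x y.
  move=> /allP pxy; apply/saturated_link_count => // p pPi xp.
  by have := pxy p pPi; rewrite xp.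
have [/preP|/allPn[p pPi]] := boolP (pre i j); first by constructor 2.
have [/preP|/allPn[q qPi]] := boolP (pre j i); first by constructor 3.
rewrite !negb_imply !wprefNpref !negbK => /andP[jq jqi] /andP[ip ipj].
by case: F2; exists i, j; split=> //; exists p, q.
Qed.

(** Stability exempts every pair of multiplicity 2, while (F2) exempts only transpositions;
    requiring each such pair to occur as a transposition reconciles the two. *)
Lemma gsp_of_nat_stable (A : finType) (I : sf_instance A)
    (Pi : seq ({set A} * {perm A})) :
  (forall p, p \in Pi -> cyclic_perm p) ->
  uniq [seq p : {set A} * {perm A} <- Pi | #|p.1| != 1] ->
  (forall p, p \in Pi -> forall k, k \in p.1 ->
     wpref I k (p.2 k) ((p.2)^-1%g k)) ->
  (forall k, count (fun p : {set A} * {perm A} => k \in p.1) Pi = cap I k) ->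
  (forall i j, i != j -> link_count Pi i j <= 2) ->
  (forall i j, i != j -> link_count Pi i j = 2 ->
     ([set i; j], tperm i j) \in Pi) ->
  nat_stable I (link_count Pi) -> gsp I Pi.
Proof.
move=> cyc dist F1 F3 F4 full stab; split=> //.
have satN x y (p : {set A} * {perm A}) : p \in Pi -> x \in p.1 ->
    pref I x y ((p.2)^-1%g x) -> ~ saturated I (link_count Pi) x y.
  move=> pPi xp pxy /(saturated_link_count x y cyc F1 F3)/(_ p pPi xp).
  by rewrite wprefNpref pxy.
move=> [i [j [ij /negP tNPi [p [q [[pPi qPi] [ip jq] ipj jqi]]]]]].
case: (stab i j ij) => [/(full i j ij)//|/satN|/satN].
  by apply; [exact: pPi| |].
by apply; [exact: qPi| |].
Qed.

(** * Tools for double counting, and the simplest cyclic permutations *)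

Lemma eq_of_leq_sum (T : finType) (f g : T -> nat) :
  (forall i, f i <= g i) -> \sum_i g i <= \sum_i f i -> forall i, f i = g i.
Proof.
move=> le_fg le_gf i; move: le_gf.
rewrite (bigD1 i) //= [X in _ <= X](bigD1 i) //=.
have := le_fg i; have := @leq_sum _ (index_enum T) (predC1 i) f g.
by move=> /(_ (fun j _ => le_fg j)) /=; lia.
Qed.

Lemma count_enum_set (T : finType) (a : pred T) (B : {set T}) :
  count a (enum B) = #|[set x in B | a x]|.
Proof.
rewrite -sum1_count big_enum_cond sum1_card.
by apply: eq_card => x; rewrite !inE.
Qed.

Lemma cyclic_fixed_point (A : finType) (i : A) :
  cyclic_perm ([set i], 1%g : {perm A}).
Proof.
rewrite /cyclic_perm perm_on1; apply/existsP; exists i.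
rewrite !inE eqxx; apply/eqP/setP => k; apply/idP/idP => [/porbitP[n ->]|].
  by rewrite expg1n perm1 inE.
by rewrite inE => /eqP->; apply: porbit_id.
Qed.

Definition transposition (A : finType) (i j : A) : {set A} * {perm A} :=
  ([set i; j], tperm i j).

Lemma cyclic_transposition (A : finType) (i j : A) :
  cyclic_perm (transposition i j).
Proof.
rewrite /cyclic_perm tperm_on; apply/existsP; exists i.
rewrite !inE eqxx; apply/eqP/setP => k; apply/idP/idP => [/porbitP[n ->]|].
  elim: n => [|n IH]; first by rewrite perm1 !inE eqxx.
  by rewrite expgSr permM (perm_closed _ (tperm_on i j)).
rewrite !inE => /orP[]/eqP->; first exact: porbit_id.
by have := mem_porbit (tperm i j) 1 i; rewrite expg1 tpermL.
Qed.

(** * The graph of half-edges of a stable multiplicity function *)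

Section HalfGraph.

Variables (A : finType) (I : sf_instance A) (v : A -> A -> nat).
Hypothesis vC : forall i j, v i j = v j i.
Hypothesis vii : forall i, v i i = 0.
Hypothesis v2 : forall i j, v i j <= 2.
Hypothesis vcap : forall i, \sum_j v i j <= (cap I i).*2.
Hypothesis vstable : nat_stable I v.

Definition least (i j : A) : bool :=
  [&& v i j == 1, \sum_l v i l == (cap I i).*2 &
      [forall l, (0 < v i l) ==> wpref I i l j]].

Definition fulls (i : A) : {set A} := [set j | v i j == 2].

(** Partners at least as good as [j] already use up the bound [vcap], so nothing is left for worse
    ones. *)
Lemma saturated_worst i j : saturated I v i j ->
  \sum_l v i l = (cap I i).*2 /\ forall l, 0 < v i l -> wpref I i l j.
Proof.
rewrite /saturated => sat; have := vcap i.
rewrite (bigID (fun l => wpref I i l j)) /= sat => le_cap.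
have rest0 : \sum_(l | ~~ wpref I i l j) v i l == 0 by move: le_cap; lia.
rewrite (eqP rest0) addn0; split=> // l; apply: contraLR => wNlj.
by move: rest0; rewrite sum_nat_eq0 => /forall_inP/(_ l wNlj)/eqP->.
Qed.

Lemma half_least i j : v i j = 1 -> least i j || least j i.
Proof.
move=> vij; have ij : i != j by apply: contra_eq_neq vij => ->; rewrite vii.
have leastI x y : v x y = 1 -> saturated I v x y -> least x y.
  move=> vxy /saturated_worst[/eqP sat worst]; rewrite /least vxy sat /=.
  by apply/forallP => l; apply/implyP/worst.
case: (vstable ij) => [|/leastI->//|/leastI->]; first by rewrite vij.
  by rewrite orbT.
by rewrite vC.
Qed.

Lemma least_half i j : least i j -> v i j = 1.
Proof. by case/and3P => /eqP. Qed.

Lemma least_wpref i j l : least i j -> 0 < v i l -> wpref I i l j.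
Proof. by case/and3P => _ _ /forallP/(_ l)/implyP. Qed.

Lemma least_inj i j k : least i j -> least i k -> j = k.
Proof.
move=> lij lik; apply: (@wpref_anti A I i).
  by apply: least_wpref lik _; rewrite (least_half lij).
by apply: least_wpref lij _; rewrite (least_half lik).
Qed.

Lemma leastii i : least i i = false.
Proof. by rewrite /least vii. Qed.

Lemma sum_v i : \sum_j v i j = \sum_j (v i j == 1) + #|fulls i|.*2.
Proof.
rewrite -sum1_card -mul2n big_distrr /= [X in (_ + X)%N]big_mkcond.
rewrite -big_split /=.
apply: eq_bigr => j _; rewrite inE; have := v2 i j.
by case: (v i j) => [|[|[|]]].
Qed.

Lemma sum_least i : \sum_j least i j = [exists j, least i j].
Proof.
case: existsP => [[j lij]|lN].
  rewrite (bigD1 j) //= lij big1 // => k kj.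
  by apply/eqP; rewrite eqb0; apply: contra kj => /(least_inj lij)->.
rewrite big1 // => j _; apply/eqP; rewrite eqb0; apply/negP => lij.
by case: lN; exists j.
Qed.

(** If [i] has a least half-edge, its total is even; full edges contribute evenly, so the number of
    half-edges at [i] is even and positive, hence at least 2. *)
Lemma least_degree i : (\sum_j least i j).*2 <= \sum_j (v i j == 1).
Proof.
rewrite sum_least; case: existsP => // -[j lij].
have := sum_v i; have /and3P[_ /eqP-> _] := lij.
rewrite (bigD1 j) //= (least_half lij) eqxx; lia.
Qed.

(** Stability covers every half-edge by [least] at one end or the other, so the half-degrees sum to
    at most twice the number of [least] pairs. [least_degree] gives the reverse bound, so every
    inequality involved is an equality. *)
Lemma least_count :
  (forall i, (\sum_j least i j).*2 = \sum_j (v i j == 1)) /\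
  (forall i j, (v i j == 1) = least i j + least j i :> nat).
Proof.
have cover i j : (v i j == 1) <= least i j + least j i.
  by case: eqP => // /half_least; case: (least i j); case: (least j i).
have sum_cover : \sum_i \sum_j (least i j + least j i) =
    \sum_i (\sum_j least i j).*2.
  under eq_bigr do rewrite big_split /=.
  rewrite big_split /= [X in (_ + X)%N]exchange_big -big_split /=.
  by under eq_bigr do rewrite addnn.
have deg : forall i, (\sum_j least i j).*2 = \sum_j (v i j == 1).
  apply: eq_of_leq_sum least_degree _; rewrite -sum_cover.
  by apply: leq_sum => i _; apply: leq_sum.
split=> // i; apply: eq_of_leq_sum => //.
(* The totals agree, so the row sums agree by [cover]; within a row the entries then agree for the
   same reason. *)
have /(_ i)<-// : forall k,
    \sum_j (v k j == 1) = \sum_j (least k j + least j k).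
apply: eq_of_leq_sum => [k|]; first exact: leq_sum.
by rewrite sum_cover; under eq_bigr do rewrite deg.
Qed.

Lemma halfE i j : (v i j == 1) = least i j + least j i :> nat.
Proof. by have [_ ->] := least_count. Qed.

(** The half-degree of [j] is twice its out-degree under [least], and also its out-degree plus its
    in-degree. *)
Lemma sum_least_col j : \sum_i least i j = \sum_i least j i.
Proof.
have [/(_ j) deg half] := least_count; move: deg.
by under [RHS]eq_bigr do rewrite half; rewrite big_split /=; lia.
Qed.

(** * The permutation sending an agent to its least half-partner *)

Definition worst (i : A) : A := odflt i [pick j | least i j].

Lemma worst_least i j : j != i -> (worst i == j) = least i j.
Proof.
rewrite /worst; case: pickP => [k lik|lN] /=; last first.
  by rewrite lN eq_sym => /negPf.
by move=> _; apply/eqP/idP => [<-//|/(least_inj lik)].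
Qed.

(** The default value [i] in [worst] is safe because [least] is irreflexive: fixed points are
    exactly the agents without a least half-partner. *)
Lemma worst_neq i : (worst i != i) = [exists j, least i j].
Proof.
rewrite /worst; case: pickP => [k lik|lN] /=.
  have -> : [exists j, least i j] by apply/existsP; exists k.
  by apply/eqP => ki; move: lik; rewrite ki leastii.
by rewrite eqxx; apply/esym/existsP => -[j]; rewrite lN.
Qed.

Lemma least_worst i : worst i != i -> least i (worst i).
Proof. by move=> wi; rewrite -worst_least. Qed.

Lemma worst_inj : injective worst.
Proof.
(* A fixed point has out-degree 0 under [least], hence in-degree 0, so no other agent is sent to
   it. *)
have fixN i j : worst j = j -> worst i = j -> i = j.
  move=> wj wi; apply/eqP; apply: contraT => ij.
  have := sum_least_col j; rewrite [RHS]sum_least -worst_neq wj eqxx => /eqP.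
  rewrite sum_nat_eq0 => /forallP/(_ i)/=; rewrite -worst_least 1?eq_sym //.
  by rewrite wi eqxx.
move=> i j wij; have [wi|wi] := eqVneq (worst i) i.
  by rewrite (fixN j i) // -wij.
have [wj|wj] := eqVneq (worst j) j; first by rewrite (fixN i j) // wij.
apply/eqP; apply: contraT => ij.
(* Distinct [i] and [j] would give their common value in-degree at least 2, but its out-degree is at
   most 1. *)
have := sum_least_col (worst i).
rewrite [RHS]sum_least (bigD1 i) //= least_worst // (bigD1 j) 1?eq_sym //=.
by rewrite wij least_worst //; case: [exists _, _].
Qed.

(** * The partition: transpositions, cycles and fixed points *)

Definition to_worst : {perm A} := perm worst_inj.

(** The inverse is taken so that the predecessor of an agent is its least half-partner, as (F1)
    demands. *)
Definition cycle_through (i : A) : {set A} * {perm A} :=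
  let S := porbit to_worst i in (S, restr_perm S to_worst^-1).

Definition cycles : {set {set A} * {perm A}} :=
  [set cycle_through i | i in [pred i | worst i != i]].

Definition transpositions : {set {set A} * {perm A}} :=
  [set p | [exists i, exists j,
     (j \in fulls i) && (p == transposition i j)]].

(** The two half-edges of an agent on a cycle use one unit of capacity. The subtraction never
    truncates, by [vcap] and the evenness of the total. *)
Definition deficit (i : A) : nat := cap I i - #|fulls i| - (worst i != i).

Definition fixed_points : seq ({set A} * {perm A}) :=
  flatten [seq nseq (deficit i) ([set i], 1%g) | i <- enum A].

Definition stable_partition : seq ({set A} * {perm A}) :=
  enum transpositions ++ enum cycles ++ fixed_points.

Lemma restr_cycle i j : j \in porbit to_worst i ->
  (cycle_through i).2 j = (to_worst^-1)%g j.
Proof.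
move=> ji; apply: restr_permE => //; apply/astabsP => x /=.
rewrite /aperm -!eq_porbit_mem; congr (_ == _).
by rewrite -!(porbitV to_worst) (porbit_perm _ 1).
Qed.

Lemma restr_cycleV i j : j \in porbit to_worst i ->
  ((cycle_through i).2)^-1%g j = worst j.
Proof.
move=> ji; apply: (@perm_inj _ (cycle_through i).2); rewrite permKV restr_cycle.
  by rewrite -[worst j](permE worst_inj) permK.
rewrite -eq_porbit_mem -[worst j](permE worst_inj) (porbit_perm _ 1).
by rewrite eq_porbit_mem.
Qed.

Lemma cyclic_cycle i : cyclic_perm (cycle_through i).
Proof.
rewrite /cyclic_perm restr_perm_on; apply/existsP; exists i.
rewrite porbit_id; apply/eqP/setP => j; apply/idP/idP => [/porbitP[n ->]|].
  elim: n => [|n IH]; first by rewrite perm1 porbit_id.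
  by rewrite expgSr permM (perm_closed _ (restr_perm_on _ _)).
(* The restriction follows the inverse along the whole orbit of [i], so it still reaches every point
   of that orbit. *)
have powE n : ((cycle_through i).2 ^+ n)%g i = (to_worst^-1 ^+ n)%g i.
  elim: n => [|n IH]; first by rewrite !perm1.
  by rewrite !expgSr !permM IH restr_cycle // -porbitV mem_porbit.
move=> ji; have /porbitP[n ->] : j \in porbit to_worst^-1 i by rewrite porbitV.
by rewrite -powE mem_porbit.
Qed.

Lemma cyclesP p i : p \in cycles -> i \in p.1 ->
  p = cycle_through i /\ worst i != i.
Proof.
case/imsetP => k; rewrite inE => wk -> /= ik.
move: (ik); rewrite -eq_porbit_mem /cycle_through => /eqP<-; split=> //.
(* If [worst] fixed [i], the orbit would reduce to [i], so [k] would be fixed too. *)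
apply: contra wk => /eqP wi; move: ik; rewrite porbit_sym => /porbitP[n ->].
have fix_i : to_worst i = i by rewrite permE.
have -> : (to_worst ^+ n)%g i = i; last by rewrite wi.
by elim: n => [|n IH]; rewrite ?perm1 // expgSr permM IH.
Qed.

Lemma transpositionsP p i : p \in transpositions -> i \in p.1 ->
  exists2 j, j \in fulls i & p = transposition i j.
Proof.
rewrite inE => /existsP[k /existsP[l /andP[kl /eqP->]]].
rewrite !inE => /orP[]/eqP->; first by exists l.
exists k; first by move: kl; rewrite !inE vC.
by rewrite /transposition setUC tpermC.
Qed.

Lemma fixed_pointsP p : p \in fixed_points -> exists i, p = ([set i], 1%g).
Proof.
case/flattenP => s /mapP[i _ ->]; rewrite mem_nseq => /andP[_ /eqP->].
by exists i.
Qed.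

(** Orbits are disjoint, so at most one member of [cycles] contains [i]. *)
Lemma count_cycles i (P : pred ({set A} * {perm A})) :
  count (fun p : {set A} * {perm A} => (i \in p.1) && P p) (enum cycles) =
  (worst i != i) && P (cycle_through i).
Proof.
rewrite count_enum_set.
have [wi|wi] /= := boolP (worst i != i); last first.
  rewrite eq_card0 // => p; rewrite !inE; apply/negP => /and3P[pC ip _].
  by have [_ wiN] := cyclesP pC ip; rewrite wiN in wi.
have [Pi|PiN] := boolP (P _).
  rewrite (eq_card (B := pred1 (cycle_through i))) ?card1 // => p.
  rewrite !inE; apply/and3P/eqP => [[pC ip _]|->].
    by have [] := cyclesP pC ip.
  by split; rewrite ?porbit_id //; apply: imset_f.
rewrite eq_card0 // => p; rewrite !inE; apply/negP => /and3P[pC ip].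
by have [-> _] := cyclesP pC ip; rewrite (negPf PiN).
Qed.

Lemma count_transpositions i (P : pred ({set A} * {perm A})) :
  count (fun p : {set A} * {perm A} => (i \in p.1) && P p)
    (enum transpositions) =
  #|[set j in fulls i | P (transposition i j)]|.
Proof.
rewrite count_enum_set -(@card_imset _ _ (transposition i)); last first.
  by move=> j k [_ /(congr1 (fun s : {perm A} => s i))]; rewrite !tpermL.
apply: eq_card => p; rewrite inE; apply/and3P/imsetP => [[pT ip Pp]|[j]].
  have [j fij pE] := transpositionsP pT ip.
  by exists j; rewrite // inE fij -pE.
rewrite inE => /andP[fij Pj] ->; split=> //; last by rewrite !inE eqxx.
rewrite inE; apply/existsP; exists i; apply/existsP; exists j.
by rewrite fij eqxx.
Qed.

Lemma count_fixed_points i (P : pred ({set A} * {perm A})) :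
  count (fun p : {set A} * {perm A} => (i \in p.1) && P p) fixed_points =
  deficit i * P ([set i], 1%g).
Proof.
rewrite count_flatten -map_comp sumnE big_map big_enum (bigD1 i) //=.
rewrite count_nseq !inE eqxx mulnC /= big1 ?addn0 // => k ki.
by rewrite /= count_nseq inE eq_sym (negPf ki).
Qed.

Lemma count_stable_partition i (P : pred ({set A} * {perm A})) :
  count (fun p : {set A} * {perm A} => (i \in p.1) && P p) stable_partition =
  #|[set j in fulls i | P (transposition i j)]|
  + ((worst i != i) && P (cycle_through i)) + deficit i * P ([set i], 1%g).
Proof.
rewrite !count_cat addnA.
by rewrite count_transpositions count_cycles count_fixed_points.
Qed.

Lemma count_stable_partition_cap i :
  count (fun p : {set A} * {perm A} => i \in p.1) stable_partition = cap I i.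
Proof.
have -> : count (fun p : {set A} * {perm A} => i \in p.1) stable_partition =
    count (fun p : {set A} * {perm A} =>
      (i \in p.1) && true) stable_partition.
  by apply: eq_count => p; rewrite andbT.
rewrite (count_stable_partition i xpredT) andbT muln1.
rewrite (eq_card (B := fulls i)) => [|j]; last by rewrite !inE andbT.
rewrite /deficit; have := vcap i; rewrite sum_v.
have [<- _] := least_count; rewrite sum_least -worst_neq.
by move: (nat_of_bool _) => y; lia.
Qed.

Lemma succ_stable_partition i j : i != j ->
  succ_count stable_partition i j = (v i j == 2) + least j i.
Proof.
move=> ij; have ji : j != i by rewrite eq_sym.
rewrite /succ_count.
rewrite (count_stable_partition i
  (fun p : {set A} * {perm A} => p.2 i == j)) /=.
rewrite perm1 (negPf ij) muln0 addn0; congr (_ + nat_of_bool _).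
  have [vij|vij] := boolP (v i j == 2).
    rewrite (eq_card (B := pred1 j)) ?card1 // => k; rewrite !inE tpermL.
    by case: (eqVneq k j) => [->|_]; rewrite ?vij ?andbF.
  rewrite eq_card0 // => k; rewrite !inE tpermL.
  by case: (eqVneq k j) => [->|_]; rewrite ?(negPf vij) ?andbF.
rewrite restr_cycle ?porbit_id // (can2_eq (permKV _) (permK _)).
(* When [i] is fixed by [worst] and so lies on no cycle, injectivity forbids [worst j = i], so both
   sides vanish. *)
rewrite -worst_least // permE (eq_sym i); case: eqVneq => //= wi.
by apply/esym/negP => /eqP wj; case/eqP: ij; apply: worst_inj; rewrite wi wj.
Qed.

Lemma link_stable_partition i j : i != j ->
  link_count stable_partition i j = v i j.
Proof.
move=> ij; have ji : j != i by rewrite eq_sym.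
rewrite /link_count (succ_stable_partition ij) (succ_stable_partition ji).
have := halfE i j; have := v2 i j; rewrite (vC j i).
by case: (v i j) => [|[|[|]]] //=; case: (least i j); case: (least j i).
Qed.

Lemma stable_partition_F1 p : p \in stable_partition ->
  forall j, j \in p.1 -> wpref I j (p.2 j) ((p.2)^-1%g j).
Proof.
rewrite !mem_cat !mem_enum => /or3P[pT|pC|/fixed_pointsP[i ->]] j jp.
- by have [k _ ->] := transpositionsP pT jp; rewrite /= tpermV wpref_refl.
- have [-> wj] := cyclesP pC jp; have lj := least_worst wj.
  rewrite restr_cycle ?restr_cycleV ?porbit_id //.
  (* The successor [k] satisfies [worst k = j], so it is a half-partner of [j] and cannot be worse
     than the least one. *)
  apply: least_wpref lj _; set k := (to_worst^-1)%g j.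
  have wk : worst k = j by rewrite -[worst k](permE worst_inj) permKV.
  have kj : j != k by apply: contra_neq wj => jk; rewrite [in LHS]jk.
  by rewrite vC (@least_half k j) // -worst_least // wk.
- by rewrite /= invg1 wpref_refl.
Qed.

Lemma uniq_stable_partition :
  uniq [seq p : {set A} * {perm A} <- stable_partition | #|p.1| != 1].
Proof.
rewrite /stable_partition catA filter_cat [X in _ ++ X](_ : _ = [::]) ?cats0.
  apply: filter_uniq; rewrite cat_uniq !enum_uniq andbT /=.
  apply/hasPn => p; rewrite !mem_enum => /imsetP[i]; rewrite inE => wi pE.
  apply/negP => pT; have ip : i \in p.1 by rewrite pE porbit_id.
  have [j] := transpositionsP pT ip; rewrite inE => /eqP vij.
  (* If a cycle were also a listed transposition, the predecessor of [i] would have multiplicity 1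
     from the cycle and 2 from the transposition. *)
  rewrite pE => /(congr1 (fun p : {set A} * {perm A} => (p.2)^-1%g i)) /=.
  rewrite restr_cycleV ?porbit_id // tpermV tpermL => wij.
  by have := least_half (least_worst wi); rewrite wij vij.
rewrite (eq_in_filter (a2 := pred0)) ?filter_pred0 // => p.
by case/fixed_pointsP => i ->; rewrite cards1.
Qed.

Lemma gsp_stable_partition : gsp I stable_partition.
Proof.
apply: gsp_of_nat_stable.
- move=> p; rewrite !mem_cat !mem_enum.
  case/or3P => [|/imsetP[i _ ->]|/fixed_pointsP[i ->]].
  + rewrite inE => /existsP[i /existsP[j /andP[_ /eqP->]]].
    exact: cyclic_transposition.
  + exact: cyclic_cycle.
  + exact: cyclic_fixed_point.
- exact: uniq_stable_partition.
- exact: stable_partition_F1.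
- exact: count_stable_partition_cap.
- by move=> i j ij; rewrite link_stable_partition.
- move=> i j ij; rewrite link_stable_partition // => vij.
  rewrite mem_cat mem_enum inE; apply/orP; left.
  by apply/existsP; exists i; apply/existsP; exists j; rewrite inE vij !eqxx.
move=> i j ij; rewrite link_stable_partition //.
(* Only off-diagonal values enter this sum, and there the link counts agree with [v]. *)
have satE x y : x != y -> saturated I v x y ->
    saturated I (link_count stable_partition) x y.
  move=> xy; rewrite /saturated => <-; apply: eq_bigr => k wk.
  rewrite link_stable_partition //; apply: contraL wk => /eqP<-.
  by rewrite wpref_self // eq_sym.
case: (vstable ij) => [|/satE st|/satE st]; first by constructor 1.
  by constructor 2; apply: st.
by constructor 3; apply: st; rewrite eq_sym.
Qed.

End HalfGraph.

(** * Doubling a given half-matching, and the correspondence *)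

Lemma doubled_exists (A : finType) (w : {ffun agent_pair A -> rat}) :
  (forall e, w e \in [:: 0; 1 / 2%:R; 1]%R) ->
  exists v : A -> A -> nat, [/\ doubled w v, forall i j, v i j = v j i &
    forall i, v i i = 0].
Proof.
(* On 0, 1/2 and 1 the summand equals [2 * w e]. The sum has one term for [i != j] and none on the
   diagonal, which yields both symmetry and [v i i = 0]. *)
move=> w012; pose v i j := (\sum_(e : agent_pair A | val e == [set i; j])
  ((w e != 0%R) + (w e == 1%R)))%N.
exists v; split=> [e i j ij eE|i j|i].
- rewrite /v (big_pred1 e) => [|f]; last by rewrite /= -eE val_eqE.
  have := w012 e; rewrite !inE => /or3P[]/eqP->.
  + by rewrite eqxx mul0r.
  + by [].
  + by rewrite eqxx oner_eq0 divff.
- by rewrite /v setUC.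
rewrite /v big_pred0 // => e; apply/negP => /eqP eE.
by have := valP e; rewrite eE setUid cards1.
Qed.

Theorem theorem6 (A : finType) (I : sf_instance A) :
  (forall Pi : seq ({set A} * {perm A}), gsp I Pi ->
     half_matching I (gsp_half_matching Pi) /\
     stable I (gsp_half_matching Pi)) /\
  (forall w : {ffun agent_pair A -> rat},
     half_matching I w -> stable I w ->
     exists2 Pi : seq ({set A} * {perm A}),
       gsp I Pi & gsp_half_matching Pi = w).
Proof.
split=> [Pi gPi|w hw sw].
  have dPi := doubled_link_count Pi; have [cyc _ _ _ F3 F4] := gPi.
  split; last by apply/(doubled_stable I dPi)/gsp_nat_stable.
  apply/(doubled_half_matching I dPi); split=> // i.
  (* Successors and predecessors of [i] are each counted at most once per cycle through [i]. *)
  rewrite sum_link_count // -addnn -F3.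
  by apply: leq_add; apply: sub_count => p /andP[].
have [w012 _] := hw; have [v [wv vC vii]] := doubled_exists w012.
have /(doubled_half_matching I wv)[v2 vcap] := hw.
have vst := (doubled_stable I wv).1 sw.
have v2' i j : v i j <= 2.
  by have [->|] := eqVneq i j; [rewrite vii | apply: v2].
have vcap' i : \sum_j v i j <= (cap I i).*2.
  by rewrite (bigD1 i) //= vii; apply: vcap.
exists (stable_partition vC vii v2' vcap' vst).
  exact: gsp_stable_partition.
apply/ffunP => e; have /cards2P[i [j [ij eE]]] := valP e.
by rewrite (doubled_link_count _ ij eE) link_stable_partition // -(wv e).
Qed.
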